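(* Let $n\ge 2$ and let $-1=x_1<x_2<\cdots<x_n=1$ be real numbers. 1. For any labels $y_1,\ldots,y_n\in\mathbb{R}$, there exists $\mu\in\mathcal{M}(\mathbb{U},\mathbb{R})$ with $\operatorname{supp}(\mu)\subseteq F_{reg}$ which is optimal (attains the infimum) for the regression problem $$\inf_{\mu\in\mathcal{M}(\mathbb{U},\mathbb{R})}\int_{\mathbb{U}}|d\mu(u)| \quad\text{subject to}\quad f_\mu(x_i)=y_i\ \ \forall i\in[n].$$ 2. For any $k\ge 1$ and labels $y_1,\ldots,y_n\in[k]$, there exists $\nu\in\mathcal{M}(\mathbb{U},\mathbb{R}^k)$ with $\operatorname{supp}(\nu)\subseteq F_{class}$ which is optimal (attains the infimum) for the classification problem $$\inf_{\mu\in\mathcal{M}(\mathbb{U},\mathbb{R}^k)}\int_{\mathbb{U}}\|d\mu(u)\| \quad\text{subject to}\quad (e_{y_i}-e_l)^T f_\mu(x_i)\ge \mathbb{1}(y_i\neq l)\ \ \forall i\in[n],\ \forall l\in[k].$$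
   Context: $[n]=\{1,\ldots,n\}$; $e_j$ is the $j$-th canonical basis vector of $\mathbb{R}^k$; $\mathbb{1}(y_i\neq l)$ is $1$ if $y_i\neq l$ and $0$ otherwise. Let $\mathbb{U}=\{-1,1\}\times[-1,1]$. For $u=(s,c)\in\mathbb{U}$ and $x\in\mathbb{R}$ let $\phi_u(x)=(s(x-c))_+$, where $(t)_+=\max(t,0)$. $\mathcal{M}(\mathbb{U},\mathbb{R}^k)$ denotes the set of (finite) signed Radon measures on $\mathbb{U}$ with values in $\mathbb{R}^k$, and for such $\mu$, $f_\mu(x)=\int_{\mathbb{U}}\phi_u(x)\,d\mu(u)\in\mathbb{R}^k$. $\int_{\mathbb{U}}|d\mu(u)|$ is the total variation of a real measure and $\int_{\mathbb{U}}\|d\mu(u)\|$ is the total variation of a vector measure with respect to the Euclidean norm $\|\cdot\|$ on $\mathbb{R}^k$. Define $R_{reg}=\{x_1,x_n\}\cup\left\{x_i: 2\le i\le n-1,\ \frac{y_{i+1}-y_i}{x_{i+1}-x_i}\neq\frac{y_i-y_{i-1}}{x_i-x_{i-1}}\right\}$ (for real labels) and $F_{reg}=\{-1,1\}\times R_{reg}$. Define $R_{class}=\{x_1,x_n\}\cup\{x_i: 2\le i\le n-1,\ y_{i-1}\neq y_i \text{ or } y_{i+1}\neq y_i\}$ (for labels in $[k]$) and $F_{class}=\{-1,1\}\times R_{class}$. *)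

(* Defs.v *)
From HB Require Import structures.
From mathcomp Require Import all_boot all_order all_algebra.
From mathcomp Require Import all_classical all_reals all_analysis.
Set Implicit Arguments. Unset Strict Implicit. Unset Printing Implicit Defensive.
Import Order.TTheory GRing.Theory Num.Theory.
Import numFieldNormedType.Exports.
Local Open Scope classical_set_scope.
Local Open Scope ring_scope.

Definition Uset (R : realType) : set (R * R) :=
  [set u | (u.1 = 1 \/ u.1 = -1) /\ -1 <= u.2 <= 1].

Definition phi (R : realType) (u : R * R) (x : R) : R :=
  Num.max (u.1 * (x - u.2)) 0.

(* A finite signed (Radon) measure on U, represented as the difference
   pos - neg of two finite (Borel) measures on R x R concentrated on U.
   Every finite signed measure on U arises this way (Jordan decomposition),
   and all quantities below depend only on the difference. *)
Record smeasure (R : realType) := SMeasure {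
  sm_pos : {finite_measure set (R * R)%type -> \bar R};
  sm_neg : {finite_measure set (R * R)%type -> \bar R};
  sm_pos_U : sm_pos (~` @Uset R) = 0%E;
  sm_neg_U : sm_neg (~` @Uset R) = 0%E }.

Definition sm_val (R : realType) (mu : smeasure R) (A : set (R * R)) : R :=
  fine (sm_pos mu A) - fine (sm_neg mu A).

Definition fmu (R : realType) (mu : smeasure R) (x : R) : R :=
  fine (\int[sm_pos mu]_(u in @Uset R) (phi u x)%:E) -
  fine (\int[sm_neg mu]_(u in @Uset R) (phi u x)%:E).

Definition tvar d (T : measurableType d) (R : realType)
  (nrm : set T -> R) (A : set T) : \bar R :=
  ereal_sup [set v | exists (m : nat) (F : nat -> set T),
    (forall i, measurable (F i)) /\ trivIset `I_m F /\
    \big[setU/set0]_(i < m) F i = A /\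
    v = (\sum_(i < m) nrm (F i))%:E].

Definition tv1 (R : realType) (mu : smeasure R) (A : set (R * R)) : \bar R :=
  tvar (fun B => `|sm_val mu B|) A.

Definition tvk (R : realType) (k : nat) (mu : 'I_k -> smeasure R)
  (A : set (R * R)) : \bar R :=
  tvar (fun B => Num.sqrt (\sum_(l < k) (sm_val (mu l) B) ^+ 2)) A.

Definition msupport (R : realType) (tv : set (R * R) -> \bar R) : set (R * R) :=
  [set u | forall N : set (R * R), open N -> N u -> tv N != 0%E].

(* data points are x 0 < ... < x (n-1) (0-based indexing) *)
Definition slope (R : realType) (x y : nat -> R) (i : nat) : R :=
  (y i.+1 - y i) / (x i.+1 - x i).

Definition R_reg (R : realType) (n : nat) (x y : nat -> R) : set R :=
  [set t | t = x 0%N \/ t = x n.-1 \/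
     exists i, (1 <= i)%N /\ (i <= n - 2)%N /\ slope x y i != slope x y i.-1 /\ t = x i].

Definition F_reg (R : realType) (n : nat) (x y : nat -> R) : set (R * R) :=
  [set u | (u.1 = 1 \/ u.1 = -1) /\ R_reg n x y u.2].

Definition R_class (R : realType) (k n : nat) (x : nat -> R) (y : nat -> 'I_k) : set R :=
  [set t | t = x 0%N \/ t = x n.-1 \/
     exists i, (1 <= i)%N /\ (i <= n - 2)%N /\
       (y i.-1 != y i \/ y i.+1 != y i) /\ t = x i].

Definition F_class (R : realType) (k n : nat) (x : nat -> R) (y : nat -> 'I_k) : set (R * R) :=
  [set u | (u.1 = 1 \/ u.1 = -1) /\ R_class n x y u.2].

Definition reg_feasible (R : realType) (n : nat) (x y : nat -> R) (mu : smeasure R) :=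
  forall i, (i < n)%N -> fmu mu (x i) = y i.

Definition class_feasible (R : realType) (k n : nat) (x : nat -> R) (y : nat -> 'I_k)
  (mu : 'I_k -> smeasure R) :=
  forall i, (i < n)%N -> forall l : 'I_k,
    fmu (mu (y i)) (x i) - fmu (mu l) (x i) >= (if y i != l then 1 else 0).

(* Main.v *)
Require Import Defs.
From HB Require Import structures.
From mathcomp Require Import all_boot all_order all_algebra.
From mathcomp Require Import all_classical all_reals all_analysis.
From mathcomp Require Import measurable_realfun ring lra zify.
Import Order.TTheory GRing.Theory Num.Theory.
Import numFieldNormedType.Exports.
Local Open Scope classical_set_scope.
Local Open Scope ring_scope.

(** Call the data points in [R_reg] (resp. [R_class]) nodes.  If [c] lies between
    two consecutive nodes [a < b], then at every node [phi (s, c)] is the convex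
    combination of [phi (s, a)] and [phi (s, b)] with the barycentric coordinates
    of [c].  Pushing a feasible measure to the nodes with these (hat function)
    weights therefore keeps the values of [f_mu] at the nodes; since the weights
    form a partition of unity, it does not increase the total variation.  The new
    function is affine between consecutive nodes, and so are the regression data,
    while the labels are constant there, so the remaining constraints survive by
    convexity.  It remains to minimise over measures on finitely many atoms, where
    the optimum is attained by compactness.  Both problems are instances of linear
    constraints on the vectors [f_mu (x i)]. *)

(** * The Euclidean norm on [R^k] *)

Definition enorm {R : realType} {k : nat} (v : 'I_k -> R) : R :=
  Num.sqrt (\sum_(l < k) v l ^+ 2).

Section EuclideanNorm.
Context {R : realType} {k : nat}.
Implicit Types u v : 'I_k -> R.

Lemma sumsq_ge0 v : 0 <= \sum_(l < k) v l ^+ 2.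
Proof. by apply: sumr_ge0 => l _; rewrite sqr_ge0. Qed.

Lemma enorm_ge0 v : 0 <= enorm v.
Proof. exact: sqrtr_ge0. Qed.

Lemma sqr_enorm v : enorm v ^+ 2 = \sum_(l < k) v l ^+ 2.
Proof. by rewrite sqr_sqrtr ?sumsq_ge0. Qed.

Lemma normr_le_enorm v l : `|v l| <= enorm v.
Proof.
rewrite -sqrtr_sqr ler_sqrt ?sumsq_ge0// (bigD1 l)//= lerDl.
by apply: sumr_ge0 => j _; rewrite sqr_ge0.
Qed.

Lemma enorm_le_sum_normr v : enorm v <= \sum_(l < k) `|v l|.
Proof.
have S0 : 0 <= \sum_(l < k) `|v l| by apply: sumr_ge0.
rewrite -(ger0_norm S0) -sqrtr_sqr ler_sqrt ?sqr_ge0// expr2 mulr_suml.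
apply: ler_sum => l _; rewrite -real_normK ?num_real// expr2.
by rewrite ler_wpM2l// (bigD1 l)//= lerDl sumr_ge0.
Qed.

Lemma enormZ c v : enorm (fun l => c * v l) = `|c| * enorm v.
Proof.
rewrite /enorm; under eq_bigr do rewrite exprMn.
by rewrite -mulr_sumr sqrtrM ?sqr_ge0// sqrtr_sqr.
Qed.

Lemma enorm0 : enorm (fun _ : 'I_k => 0 : R) = 0.
Proof. by rewrite /enorm big1 ?sqrtr0// => l _; rewrite expr0n. Qed.

(** With [C] the inner product, the sum of the squares of the components of [|v|^2 u - C v] equals
    [|v|^2 (|u|^2 |v|^2 - C^2)], and it is nonnegative. *)
Lemma cauchy_schwarz u v : \sum_(l < k) u l * v l <= enorm u * enorm v.
Proof.
set C := \sum_(l < k) _.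
have [v0|v0] := eqVneq (enorm v) 0.
  rewrite v0 mulr0 /C big1// => l _.
  have := normr_le_enorm v l; rewrite v0 normr_le0 => /eqP ->.
  by rewrite mulr0.
have B0 : 0 < enorm v ^+ 2 by rewrite exprn_even_gt0.
apply: (@le_trans _ _ `|C|); first exact: ler_norm.
rewrite -(@ler_pXn2r _ 2)// ?nnegrE ?mulr_ge0 ?enorm_ge0//.
rewrite exprMn real_normK ?num_real//.
have : 0 <= \sum_(l < k) (enorm v ^+ 2 * u l - C * v l) ^+ 2 by exact: sumsq_ge0.
have -> : \sum_(l < k) (enorm v ^+ 2 * u l - C * v l) ^+ 2 =
    enorm v ^+ 2 * (enorm u ^+ 2 * enorm v ^+ 2 - C ^+ 2).
  have E l : (enorm v ^+ 2 * u l - C * v l) ^+ 2 = enorm v ^+ 4 * u l ^+ 2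
    - 2 * enorm v ^+ 2 * C * (u l * v l) + C ^+ 2 * v l ^+ 2 by ring.
  under eq_bigr do rewrite E.
  rewrite big_split/= sumrB -!mulr_sumr -!sqr_enorm -/C; ring.
by rewrite pmulr_rge0// subr_ge0.
Qed.

Lemma ler_enormD u v : enorm (fun l => u l + v l) <= enorm u + enorm v.
Proof.
rewrite -(@ler_pXn2r _ 2)// ?nnegrE ?addr_ge0 ?enorm_ge0// sqrrD !sqr_enorm.
under eq_bigr do rewrite sqrrD.
rewrite 2!big_split/= lerD2r lerD2l sumrMnl lerMn2r.
exact: cauchy_schwarz.
Qed.

Lemma ler_enorm_sum (I : Type) (r : seq I) (F : I -> 'I_k -> R) :
  enorm (fun l => \sum_(i <- r) F i l) <= \sum_(i <- r) enorm (F i).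
Proof.
elim: r => [|i r IH].
  rewrite big_nil (_ : (fun l => _) = fun=> 0) ?enorm0//.
  by apply/funext => l; rewrite big_nil.
rewrite big_cons (_ : (fun l => _) = fun l => F i l + \sum_(j <- r) F j l).
  exact: le_trans (ler_enormD _ _) (lerD (lexx _) IH).
by apply/funext => l; rewrite big_cons.
Qed.

End EuclideanNorm.

(** * Total variation through finite measurable partitions *)

Section TotalVariation.
Context {d : measure_display} {T : measurableType d} {R : realType}.
Variable nrm : set T -> R.

(** Lets partitions be indexed by any finite type, such as the finite functions that label cells
    below; enumerating [V] yields the sequence that [tvar] expects. *)
Lemma le_tvar_partition (V : finType) (D : V -> set T) (A : set T) :
  nrm set0 = 0 ->
  (forall v, measurable (D v)) -> trivIset setT D ->
  (forall t, A t <-> exists v, D v t) ->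
  ((\sum_v nrm (D v))%:E <= tvar nrm A)%E.
Proof.
move=> n0 mD tD AD; apply: ereal_sup_ubound.
pose F i := if (insub i : option 'I_#|V|) is Some o then D (enum_val o) else set0.
have FE (i : 'I_#|V|) : F i = D (enum_val i) by rewrite /F valK.
exists #|V|, F; split.
  by move=> i; rewrite /F; case: insub => // o; exact: mD.
split.
  move=> i j /= ilt jlt [t []].
  rewrite /F; case: insubP => [oi _ <-|//]; case: insubP => [oj _ <-|//] => di dj.
  by congr val; apply: enum_val_inj; apply: tD => //; exists t.
split.
  apply/seteqP; split => t.
    rewrite -bigcup_mkord => -[i /= ilt]; rewrite (FE (Ordinal ilt)) => dt.
    by apply/AD; eexists; exact: dt.
  move/AD => [v dv]; rewrite -bigcup_mkord; exists (enum_rank v) => /=; first exact: ltn_ord.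
  by rewrite FE enum_rankK.
congr EFin; rewrite (reindex (fun o : 'I_#|V| => enum_val o))/=; last first.
  by apply: onW_bij; exists enum_rank; [exact: enum_valK|exact: enum_rankK].
by apply: eq_bigr => i _; rewrite FE.
Qed.

(* Pairwise disjoint sets meet each atom at most once. *)
Lemma tvar_le_atoms (N : nat) (p : 'I_N -> T) (c : 'I_N -> R) (A : set T) :
  (forall r, 0 <= c r) ->
  (forall B, nrm B <= \sum_(r < N) c r * \1_B (p r)) ->
  (tvar nrm A <= (\sum_(r < N) c r)%:E)%E.
Proof.
move=> c0 nc; apply: ge_ereal_sup => _ [m [F [mF [tF [_ ->]]]]].
rewrite lee_fin; apply: (@le_trans _ _ (\sum_(i < m) \sum_(r < N) c r * \1_(F i) (p r))).
  by apply: ler_sum => i _; exact: nc.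
rewrite exchange_big/=; apply: ler_sum => r _; rewrite -mulr_sumr.
rewrite -[leRHS]mulr1 ler_wpM2l//.
have [[i Fi]|nF] := pselect (exists i : 'I_m, F i (p r)); last first.
  by rewrite big1// => i _; rewrite indicE memNset// => Fi; apply: nF; exists i.
rewrite (bigD1 i)//= big1 ?addr0 ?indicE ?mem_set// => j ji.
rewrite indicE memNset// => Fj; move/eqP: ji; apply; apply: val_inj.
by apply: tF => //; [exact: ltn_ord|exact: ltn_ord|exists (p r)].
Qed.

Lemma tvar_eq0 (A : set T) : measurable A ->
  (forall B, B `<=` A -> nrm B = 0) -> tvar nrm A = 0%E.
Proof.
move=> mA n0; apply/eqP; rewrite eq_le; apply/andP; split.
  apply: ge_ereal_sup => _ [m [F [mF [tF [FA ->]]]]].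
  rewrite big1// => i _; apply: n0; rewrite -FA => t Ft.
  by rewrite -bigcup_mkord; exists i => //=.
(* The one-piece partition gives the lower bound [0]. For a non-measurable [A] the supremum would
   run over the empty set and be [-oo]. *)
apply: ereal_sup_ubound; exists 1%N, (fun=> A); split=> //; split.
  by move=> [|i] [|j].
by rewrite !big_ord1; split=> //; rewrite n0.
Qed.

End TotalVariation.

(** * Finite sums of weighted point masses *)

Section AtomicMeasure.
Context {d : measure_display} {T : measurableType d} {R : realType}.
Variables (w : nat -> {nonneg R}) (p : nat -> T) (N : nat).

Definition atomic : set T -> \bar R := msum (fun r => mscale (w r) (dirac (p r))) N.

HB.instance Definition _ := Measure.on atomic.

Lemma atomicE (A : set T) :
  atomic A = (\sum_(r < N) (w r)%:num * \1_A (p r))%:E.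
Proof. by rewrite /atomic /msum -sumEFin; apply: eq_bigr => r _. Qed.

Let atomic_fin : fin_num_fun atomic.
Proof. by move=> A mA; rewrite atomicE. Qed.

HB.instance Definition _ := @Measure_isFinite.Build _ _ _ atomic atomic_fin.

Lemma Rintegral_atomic (D : set T) (h : T -> R) : measurable D ->
  measurable_fun D h -> (forall t, D t -> 0 <= h t) -> (forall r, D (p r)) ->
  \int[atomic]_(t in D) h t = \sum_(r < N) (w r)%:num * h (p r).
Proof.
move=> mD mh h0 Dp; rewrite /Rintegral.
have mE : measurable_fun D (EFin \o h) by exact/measurable_EFinP.
have E0 t : D t -> (0 <= (h t)%:E)%E by move=> Dt; rewrite lee_fin h0.
rewrite /atomic ge0_integral_measure_sum//.
under eq_bigr => r _.
  rewrite ge0_integral_mscale// integral_dirac// diracE mem_set// mul1e -EFinM.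
  over.
by rewrite sumEFin.
Qed.

End AtomicMeasure.

(** * Real-valued integrals against finite measures *)

Section RealIntegral.
Context {d : measure_display} {T : measurableType d} {R : realType}.

Lemma integrable_EFin_sum (m : {measure set T -> \bar R}) (D : set T) (I : Type)
    (s : seq I) (h : I -> T -> R) : measurable D ->
  (forall i, m.-integrable D (EFin \o h i)) ->
  m.-integrable D (EFin \o (fun t => \sum_(i <- s) h i t)).
Proof.
move=> mD ih; rewrite (_ : _ \o _ = fun t => (\sum_(i <- s) (EFin \o h i) t)%E).
  exact: integrable_sum.
by apply/funext => t /=; rewrite sumEFin.
Qed.

Lemma integrable_EFinZ (m : {measure set T -> \bar R}) (D : set T) c (h : T -> R) :
  measurable D -> m.-integrable D (EFin \o h) ->
  m.-integrable D (EFin \o (fun t => c * h t)).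
Proof. by move=> mD ih; exact: (integrableZl mD c ih). Qed.

Lemma Rintegral_lincomb (m : {measure set T -> \bar R}) (D : set T) (I : Type)
    (s : seq I) (c : I -> R) (h : I -> T -> R) : measurable D ->
  (forall i, m.-integrable D (EFin \o h i)) ->
  \int[m]_(t in D) (\sum_(i <- s) c i * h i t) =
  \sum_(i <- s) c i * \int[m]_(t in D) h i t.
Proof.
move=> mD ih; elim: s => [|i s IH].
  rewrite big_nil; under eq_Rintegral do rewrite big_nil.
  by rewrite Rintegral_cst// mul0r.
rewrite big_cons -IH -RintegralZl// -RintegralD//.
- by under eq_Rintegral do rewrite big_cons.
- exact: integrable_EFinZ.
- by apply: integrable_EFin_sum => // j; exact: integrable_EFinZ.
Qed.

Lemma integrable_ge0_le (m : {finite_measure set T -> \bar R}) (D : set T)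
    (h : T -> R) (C : R) : measurable D -> measurable_fun D h ->
  (forall t, D t -> 0 <= h t <= C) -> m.-integrable D (EFin \o h).
Proof.
move=> mD mh hb; apply: measurable_bounded_integrable => //.
  by rewrite ltey_eq fin_num_measure.
exists C; split; first exact: num_real.
move=> M CM t Dt /=; have /andP[h0 hC] := hb _ Dt.
by rewrite ger0_norm// (le_trans hC)// ltW.
Qed.

Lemma Rintegral_indic (m : {finite_measure set T -> \bar R}) (D A : set T) :
  measurable D -> measurable A -> m (~` D) = 0%E ->
  \int[m]_(t in D) \1_A t = fine (m A).
Proof.
move=> mD mA mCD; rewrite /Rintegral integral_indic//.
rewrite (measureDI m mA mD) [X in fine (X + _)](_ : _ = 0%E) ?add0e//.
apply/eqP; rewrite eq_le measure_ge0 andbT -mCD le_measure// ?inE; do ?[exact: measurableD|exact: measurableC].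
Qed.

(** On [D], the simple function with value [c v] on [F v] lies below [h], at distance at most [e];
    both inequalities are integrated. *)
Lemma Rintegral_approx (m : {finite_measure set T -> \bar R}) (D : set T)
    (V : finType) (F : V -> set T) (c : V -> R) (e : R) (h : T -> R) :
  measurable D -> m (~` D) = 0%E -> m.-integrable D (EFin \o h) ->
  (forall v, measurable (F v)) -> trivIset setT F ->
  (forall t, D t -> exists v, F v t) ->
  (forall v t, F v t -> D t -> c v <= h t <= c v + e) ->
  `|\int[m]_(t in D) h t - \sum_v c v * fine (m (F v))| <= e * fine (m D).
Proof.
move=> mD mCD ih mF tF DF hc.
have iF v : m.-integrable D (EFin \o \1_(F v)).
  apply: (@integrable_ge0_le _ _ _ 1) => // t _.
  by rewrite indicE; case: (_ \in _); rewrite lexx ler01.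
have -> : \sum_v c v * fine (m (F v)) = \int[m]_(t in D) (\sum_v c v * \1_(F v) t).
  by rewrite Rintegral_lincomb//; apply: eq_bigr => v _; rewrite Rintegral_indic.
have iS : m.-integrable D (EFin \o (fun t => \sum_v c v * \1_(F v) t)).
  by apply: integrable_EFin_sum => // v; exact: integrable_EFinZ.
have SE v t : F v t -> \sum_v c v * \1_(F v) t = c v.
  move=> Fvt; rewrite (bigD1 v)//= indicE mem_set// mulr1 big1 ?addr0// => j jv.
  rewrite indicE memNset ?mulr0// => Fjt; move/eqP: jv; apply.
  by apply: tF => //; exists t.
rewrite -RintegralB// -Rintegral_cst// ler_norml; apply/andP; split.
  apply: (@le_trans _ _ 0).
    rewrite oppr_le0; apply: Rintegral_ge0 => t Dt.
    have [v Fv] := DF _ Dt; have := hc _ _ Fv Dt; lra.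
  apply: Rintegral_ge0 => t Dt.
  have [v Fv] := DF _ Dt; have := hc _ _ Fv Dt; rewrite (SE v)//; lra.
apply: le_Rintegral => //.
- exact: (integrableB mD ih iS).
- exact: finite_measure_integrable_cst.
move=> t Dt; have [v Fv] := DF _ Dt; have := hc _ _ Fv Dt; rewrite (SE v)//; lra.
Qed.

End RealIntegral.

(** * Integrals against signed measures, and a lower bound for the total variation *)

Section SignedMeasure.
Context {R : realType}.
Implicit Types (mu : smeasure R) (u : R * R) (h : R * R -> R).

Lemma measurable_Uset : measurable (@Uset R).
Proof.
have -> : @Uset R = ([set 1] `|` [set -1]) `*` `[-1, 1]%classic.
  by apply/seteqP; split => u /=; rewrite in_itv/=.
apply: measurableX; last exact: measurable_itv.
by apply: measurableU; exact: measurable_set1.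
Qed.

Lemma measurable_phi (x : R) : measurable_fun setT (fun u => phi u x).
Proof.
apply: measurable_maxr; last exact: measurable_cst.
apply: measurable_funM; first exact: measurable_fst.
by apply: measurable_funB; [exact: measurable_cst|exact: measurable_snd].
Qed.

Lemma phi_ge0 u (x : R) : 0 <= phi u x.
Proof. by rewrite /phi le_max lexx orbT. Qed.

(** Extends the formula of [fmu] to any integrand, so that hat functions can be integrated as
    well. *)
Definition sm_int mu h : R :=
  \int[sm_pos mu]_(u in @Uset R) h u - \int[sm_neg mu]_(u in @Uset R) h u.

Lemma fmuE mu (x : R) : fmu mu x = sm_int mu (fun u => phi u x).
Proof. by []. Qed.

Lemma eq_sm_int mu h h' : (forall u, Uset u -> h u = h' u) ->
  sm_int mu h = sm_int mu h'.
Proof.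
by move=> hh'; congr (_ - _); apply: eq_Rintegral => u /set_mem; exact: hh'.
Qed.

Lemma sm_int_lincomb mu N (c C : 'I_N -> R) (h : 'I_N -> R * R -> R) :
  (forall r, measurable_fun setT (h r)) ->
  (forall r u, Uset u -> 0 <= h r u <= C r) ->
  sm_int mu (fun u => \sum_(r < N) c r * h r u) = \sum_(r < N) c r * sm_int mu (h r).
Proof.
move=> mh hb; rewrite /sm_int.
have ih (m : {finite_measure set (R * R)%type -> \bar R}) r :
    m.-integrable (@Uset R) (EFin \o h r).
  apply: (@integrable_ge0_le _ _ _ _ _ _ (C r)); first exact: measurable_Uset.
    exact: measurable_funTS.
  exact: hb.
have mU := measurable_Uset.
rewrite !Rintegral_lincomb//; do ?by move=> r; exact: ih.
by rewrite -sumrB; apply: eq_bigr => r _; rewrite mulrBr.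
Qed.

Lemma sm_val0 mu : sm_val mu set0 = 0.
Proof. by rewrite /sm_val !measure0 subrr. Qed.

Section Atoms.
Variables (w : nat -> R) (p : nat -> R * R) (N : nat).
Hypothesis pU : forall r, Uset (p r).

Let max0_ge0 (t : R) : 0 <= Num.max t 0.
Proof. by rewrite le_max lexx orbT. Qed.

Let wpos r := NngNum (max0_ge0 (w r)).
Let wneg r := NngNum (max0_ge0 (- w r)).

Let wposneg r : (wpos r)%:num - (wneg r)%:num = w r.
Proof. by rewrite /= /Num.max; case: ifPn; case: ifPn; lra. Qed.

Let atomic_out (v : nat -> {nonneg R}) : atomic v p N (~` @Uset R) = 0%E.
Proof.
rewrite atomicE big1// => r _; rewrite indicE memNset ?mulr0//.
by move=> /(_ (pU r)).
Qed.

(** The positive and negative parts of the weights give the two measures. As the points [p r] may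
    repeat, this need not be the Jordan decomposition, but [sm_val] and [fmu] see only the
    difference. *)
Definition atomic_sm : smeasure R :=
  @SMeasure R (atomic wpos p N) (atomic wneg p N) (atomic_out wpos) (atomic_out wneg).

Lemma atomic_sm_val (A : set (R * R)) :
  sm_val atomic_sm A = \sum_(r < N) w r * \1_A (p r).
Proof.
rewrite /sm_val/= !atomicE/= -sumrB; apply: eq_bigr => r _.
by rewrite -mulrBl wposneg.
Qed.

Lemma fmu_atomic_sm (x : R) :
  fmu atomic_sm x = \sum_(r < N) w r * phi (p r) x.
Proof.
have mU := measurable_Uset.
have mphi : measurable_fun (@Uset R) (fun u => phi u x).
  by apply: measurable_funTS; exact: measurable_phi.
have phi0 u : Uset u -> 0 <= phi u x by move=> _; exact: phi_ge0.
rewrite fmuE /sm_int/= !Rintegral_atomic//.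
by rewrite -sumrB; apply: eq_bigr => r _; rewrite -mulrBl wposneg.
Qed.

End Atoms.

Lemma sm_int_approx mu (V : finType) (F : V -> set (R * R)) (c : V -> R) (e : R) h :
  measurable_fun setT h -> (forall u, 0 <= h u <= 1) ->
  (forall v, measurable (F v)) -> trivIset setT F ->
  (forall u, exists v, F v u) ->
  (forall v u, F v u -> c v <= h u <= c v + e) ->
  `|sm_int mu h - \sum_v c v * sm_val mu (F v)| <=
    e * (fine (sm_pos mu (@Uset R)) + fine (sm_neg mu (@Uset R))).
Proof.
move=> mh hb mF tF FT hc.
have app (m : {finite_measure set (R * R)%type -> \bar R}) : m (~` @Uset R) = 0%E ->
    `|\int[m]_(u in @Uset R) h u - \sum_v c v * fine (m (F v))| <=
    e * fine (m (@Uset R)).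
  move=> mU; apply: Rintegral_approx => //; first exact: measurable_Uset.
    apply: (@integrable_ge0_le _ _ _ _ _ _ 1) => //; first exact: measurable_Uset.
    exact: measurable_funTS.
  by move=> v u Fv _; exact: hc.
have := app _ (sm_pos_U mu); have := app _ (sm_neg_U mu); rewrite /sm_int /sm_val.
have -> : \sum_v c v * (fine (sm_pos mu (F v)) - fine (sm_neg mu (F v))) =
    \sum_v c v * fine (sm_pos mu (F v)) - \sum_v c v * fine (sm_neg mu (F v)).
  by rewrite -sumrB; apply: eq_bigr => v _; rewrite mulrBr.
by rewrite !ler_norml mulrDr => /andP[? ?] /andP[? ?]; apply/andP; split; lra.
Qed.

(* Riemann-type approximation: cut the plane into the cells where every
   [M * h r] has a given integer part. *)
Lemma le_tvk_sm_int (k N : nat) (mu : 'I_k -> smeasure R) (h : 'I_N -> R * R -> R) :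
  (forall r, measurable_fun setT (h r)) -> (forall r u, 0 <= h r u) ->
  (forall u, \sum_(r < N) h r u <= 1) ->
  ((\sum_(r < N) enorm (fun l => sm_int (mu l) (h r)))%:E <= tvk mu setT)%E.
Proof.
move=> mh h0 h1.
have hle1 r u : h r u <= 1.
  by apply: le_trans (h1 u); rewrite (bigD1 r)//= lerDl sumr_ge0.
pose K l := fine (sm_pos (mu l) (@Uset R)) + fine (sm_neg (mu l) (@Uset R)).
have K0 l : 0 <= K l by rewrite addr_ge0// fine_ge0.
pose Kt : R := N%:R * \sum_(l < k) K l.
have Kt0 : 0 <= Kt by rewrite mulr_ge0// sumr_ge0.
apply/lee_addgt0Pr => e e0.
(* Replacing every [h r] by its lower approximation on cells of width [1 / M] costs at most [Kt / M]
   in all; [M] exceeds [Kt / e], so this is at most [e]. *)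
pose M := (Num.truncn (Kt / e)).+1.
have M0 : 0 < M%:R :> R by rewrite ltr0n.
have KM : M%:R^-1 * Kt <= e.
  rewrite mulrC ler_pdivrMr// mulrC -ler_pdivrMr//.
  by apply/ltW; exact: truncnS_gt.
(* [v r] ranges up to [M] included, because [h r] may take the value [1]. *)
pose F (v : {ffun 'I_N -> 'I_M.+1}) : set (R * R) :=
  \bigcap_(r in [set: 'I_N]) (h r @^-1` `[(v r)%:R / M%:R, (v r).+1%:R / M%:R[).
have FE v u : F v u <-> forall r, (v r)%:R <= h r u * M%:R < (v r).+1%:R.
  split=> [Fv r|Fv r _].
    by have := Fv r I; rewrite /= in_itv/= ler_pdivrMr// ltr_pdivlMr.
  by rewrite /= in_itv/= ler_pdivrMr// ltr_pdivlMr.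
have mF v : measurable (F v).
  apply: fin_bigcap_measurable => // r _; rewrite -[X in measurable X]setTI.
  exact: mh.
have tF : trivIset setT F.
  move=> v v' _ _ [u [/FE Fv /FE Fv']]; apply/ffunP => r; apply: val_inj => /=.
  have /andP[a1 a2] := Fv r; have /andP[b1 b2] := Fv' r.
  have := le_lt_trans a1 b2; have := le_lt_trans b1 a2; rewrite !ltr_nat !ltnS.
  by move=> ? ?; apply/eqP; rewrite eqn_leq; apply/andP.
have FT u : exists v, F v u.
  exists [ffun r => inord (Num.truncn (h r u * M%:R))]; apply/FE => r.
  have hM0 : 0 <= h r u * M%:R by rewrite mulr_ge0// ltW.
  rewrite ffunE inordK ?truncn_itv// ltnS -(@ler_nat R).
  apply: (@le_trans _ _ (h r u * M%:R)); first by rewrite truncn_le.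
  by rewrite -[leRHS]mul1r ler_wpM2r// ltW.
pose S r l := \sum_(v : {ffun 'I_N -> 'I_M.+1}) (v r : nat)%:R / M%:R * sm_val (mu l) (F v).
have Sapp r l : `|sm_int (mu l) (h r) - S r l| <= M%:R^-1 * K l.
  apply: sm_int_approx => //; first by move=> u; rewrite h0 hle1.
  move=> v u /FE/(_ r); rewrite -ler_pdivrMr// -ltr_pdivlMr// => /andP[-> /ltW].
  by rewrite -natr1 mulrDl mul1r.
apply: (@le_trans _ _ (\sum_v enorm (fun l => sm_val (mu l) (F v)) + e)%:E); last first.
  rewrite EFinD leeD2r//; apply: le_tvar_partition => //.
  by rewrite big1 ?sqrtr0// => l _; rewrite sm_val0 expr0n.
rewrite lee_fin; apply: (@le_trans _ _ (\sum_(r < N) (enorm (S r) +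
    \sum_(l < k) M%:R^-1 * K l))).
  apply: ler_sum => r _.
  rewrite (_ : (fun l => _) = fun l => S r l + (sm_int (mu l) (h r) - S r l)); last first.
    by apply/funext => l; rewrite addrC subrK.
  apply: le_trans (ler_enormD _ _) _; rewrite lerD2l.
  by apply: le_trans (enorm_le_sum_normr _) _; apply: ler_sum => l _; exact: Sapp.
rewrite big_split/= lerD//; last first.
  by rewrite -mulr_sumr sumr_const card_ord -mulrnAr -[X in _ * X]mulr_natl.
apply: (@le_trans _ _ (\sum_(r < N) \sum_(v : {ffun 'I_N -> 'I_M.+1}) (v r : nat)%:R / M%:R *
    enorm (fun l => sm_val (mu l) (F v)))).
  apply: ler_sum => r _.
  apply: le_trans (ler_enorm_sum _ _ _) _.
  by apply: ler_sum => v _; rewrite enormZ ger0_norm// divr_ge0.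
rewrite exchange_big/=; apply: ler_sum => v _; rewrite -mulr_suml.
(* The coefficient of a cell is the sum over [r] of [v r / M]. For a nonempty cell it is bounded by
   the sum of the [h r u] at any point [u] of the cell, hence by [1]; an empty cell contributes
   [0]. *)
have [Fv0|/set0P[u Fu]] := eqVneq (F v) set0.
  rewrite Fv0 (_ : (fun l => _) = fun=> 0) ?enorm0 ?mulr0//.
  by apply/funext => l; rewrite sm_val0.
rewrite -[leRHS]mul1r ler_wpM2r ?enorm_ge0//; apply: le_trans (h1 u).
by apply: ler_sum => r _; have /FE/(_ r)/andP[+ _] := Fu; rewrite ler_pdivrMr.
Qed.

End SignedMeasure.

(** * Continuity and existence of minimisers *)

Lemma continuous_bigsum {R : realType} (T : topologicalType) (J : Type) (s : seq J)
    (f : J -> T -> R) :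
  (forall j, continuous (f j)) -> continuous (fun a => \sum_(j <- s) f j a).
Proof.
move=> cf; elim: s => [|j s IH] a.
  by under eq_fun do rewrite big_nil; exact: cvg_cst.
under eq_fun do rewrite big_cons.
by apply: cvgD; [exact: cf|exact: IH].
Qed.

Lemma continuous_scale {R : realType} (T : topologicalType) (c : R) (f : T -> R) :
  continuous f -> continuous (fun a => c * f a).
Proof. by move=> cf a; apply: cvgM; [exact: cvg_cst|exact: cf]. Qed.

Lemma continuous_enorm {R : realType} (T : topologicalType) k (f : 'I_k -> T -> R) :
  (forall l, continuous (f l)) -> continuous (fun a => enorm (fun l => f l a)).
Proof.
move=> cf; rewrite /enorm => a.
have cs : continuous (fun a => \sum_(l < k) f l a ^+ 2).
  by apply: continuous_bigsum => l {}a; apply: cvgM; exact: cf.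
by apply: continuous_comp; [exact: cs|exact: sqrt_continuous].
Qed.

Section Minimizer.
Import ArrowAsProduct.
Context {R : realType}.

Lemma continuous_eval (I : finType) (i : I) : continuous (fun a : I -> R => a i).
Proof. exact: (@proj_continuous I (fun=> R : topologicalType) i). Qed.

(** As [c] dominates every coordinate, the points of [Q] of cost at most [c a0] lie in a cube, which
    is compact by Tychonoff's theorem. A minimum over the part of [Q] in this cube is global, since
    the other points of [Q] cost more than [c a0]. *)
Lemma coercive_min (I : finType) (Q : set (I -> R)) (c : (I -> R) -> R) :
  Q !=set0 -> closed Q -> continuous c -> (forall a i, `|a i| <= c a) ->
  exists2 a, Q a & forall b, Q b -> c a <= c b.
Proof.
move=> [a0 Qa0] clQ cc cb.
pose A := [set a : I -> R | forall i, `[- c a0, c a0]%classic (a i)] `&` Q.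
have inA a : Q a -> c a <= c a0 -> A a.
  move=> Qa ca; split=> // i; rewrite /= in_itv/= -ler_norml.
  exact: le_trans (cb a i) ca.
have cA : compact A.
  apply: compact_closedI => //.
  apply: (@tychonoff I (fun=> R : topologicalType) (fun=> `[- c a0, c a0]%classic)).
  by move=> i; exact: segment_compact.
have Aa0 : A a0 by exact: inA.
have [||a /set_mem[_ Qa] amin] := @compact_EVT_min _ R c A _ cA _.
- by exists a0.
- exact: continuous_subspaceT.
exists a => // b Qb; have [cba|/ltW cab] := leP (c b) (c a0).
  by apply: amin; apply/mem_set; exact: inA.
by apply: le_trans cab; apply: amin; exact/mem_set.
Qed.

(** The admissible weights form an intersection of closed sets, one for each linear inequality. The
    two indices are merged into the finite type ['I_k * 'I_N] so that [coercive_min] applies. *)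
Lemma polyhedral_min (k N : nat) (J : Type) (A : J -> 'I_k -> 'I_N -> R) (g : J -> R) :
  (exists a : 'I_k -> 'I_N -> R,
     forall j, g j <= \sum_(l < k) \sum_(r < N) A j l r * a l r) ->
  exists2 a : 'I_k -> 'I_N -> R,
    forall j, g j <= \sum_(l < k) \sum_(r < N) A j l r * a l r &
    forall b : 'I_k -> 'I_N -> R,
      (forall j, g j <= \sum_(l < k) \sum_(r < N) A j l r * b l r) ->
      \sum_(r < N) enorm (fun l => a l r) <= \sum_(r < N) enorm (fun l => b l r).
Proof.
move=> [a0 Qa0].
pose Q := [set a : 'I_k * 'I_N -> R |
  forall j, g j <= \sum_(l < k) \sum_(r < N) A j l r * a (l, r)].
pose c (a : 'I_k * 'I_N -> R) := \sum_(r < N) enorm (fun l => a (l, r)).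
have [||||a Qa amin] := @coercive_min _ Q c.
- by exists (fun i => a0 i.1 i.2).
- rewrite (_ : Q = \bigcap_(j in setT) ((fun a : 'I_k * 'I_N -> R =>
      \sum_(l < k) \sum_(r < N) A j l r * a (l, r)) @^-1` [set t | g j <= t])); last first.
    by apply/seteqP; split => [a Qa j _|a Qa j]; [exact: Qa|exact: (Qa j I)].
  apply: closed_bigI => j _; apply: preimage_closed; last exact: closed_ge.
  have clin : continuous (fun a : 'I_k * 'I_N -> R =>
      \sum_(l < k) \sum_(r < N) A j l r * a (l, r)).
    apply: continuous_bigsum => l; apply: continuous_bigsum => r.
    exact: (continuous_scale _ _ _ (continuous_eval _ (l, r))).
  by move=> a _; exact: clin.
- apply: continuous_bigsum => r.
  exact: (continuous_enorm _ _ _ (fun l => continuous_eval _ (l, r))).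
- move=> a [l r]; rewrite /c (bigD1 r)//=.
  apply: (le_trans (normr_le_enorm (fun l => a (l, r)) l)).
  by rewrite lerDl sumr_ge0// => ? _; exact: enorm_ge0.
exists (fun l r => a (l, r)) => // b Qb.
exact: (amin (fun i => b i.1 i.2)).
Qed.

End Minimizer.

(** * Affine behaviour of [phi] away from its kink *)

Section Ridge.
Context {R : realType}.
Implicit Types (s c t a b : R).

(** For fixed [t], the map from [c] to [phi (s, c) t] has its only kink at [c = t], so it is affine
    on [[a, b]] when [t] is not strictly inside. The factor [b - a] avoids a division. *)
Lemma phi_convex_comb s c t a b : s = 1 \/ s = -1 -> a <= c <= b ->
  t <= a \/ b <= t ->
  (b - a) * phi (s, c) t = (b - c) * phi (s, a) t + (c - a) * phi (s, b) t.
Proof.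
move=> hs /andP[ac cb] ht; rewrite /phi/=.
have nn z : z <= 0 -> Num.max z 0 = 0 by move=> z0; rewrite max_r.
have pp z : 0 <= z -> Num.max z 0 = z by move=> z0; rewrite max_l.
case: hs ht => -> [] ht; rewrite ?mul1r ?mulN1r.
- rewrite !nn; lra.
- rewrite !pp; [ring|lra..].
- rewrite !pp; [ring|lra..].
- rewrite !nn; lra.
Qed.

(** Exchanges knot and evaluation point, so that [phi_convex_comb] also yields affinity in the
    evaluation point. *)
Lemma phi_swap s c t : phi (s, c) t = phi (- s, t) c.
Proof. by rewrite /phi/=; congr (Num.max _ 0); ring. Qed.

End Ridge.

(** * Hat functions on the data grid and the reduction to nodes *)

Section Grid.
#[local] Set Implicit Arguments.
#[local] Unset Strict Implicit.
Context {R : realType}.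
Variables (n : nat) (x : nat -> R).
Hypotheses (n2 : (2 <= n)%N) (x0 : x 0%N = -1) (x1 : x n.-1 = 1).
Hypothesis xlt : forall i, (i.+1 < n)%N -> x i < x i.+1.

Lemma grid_lt i j : (i < j)%N -> (j < n)%N -> x i < x j.
Proof.
elim: j => // j IH; rewrite ltnS leq_eqVlt => /predU1P[->|ij] jn; first exact: xlt.
by apply: lt_trans (xlt jn); apply: IH => //; exact: ltnW.
Qed.

Lemma grid_le i j : (i <= j)%N -> (j < n)%N -> x i <= x j.
Proof. by rewrite leq_eqVlt => /predU1P[->//|ij] jn; exact/ltW/grid_lt. Qed.

Lemma grid_itv i : (i < n)%N -> -1 <= x i <= 1.
Proof. by move=> iN; rewrite -x0 -x1 !grid_le//; lia. Qed.

(** Provides feasible points for both problems. The values are fitted from left to right: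
    [phi (1, x m)] vanishes at [x 0, ..., x m], so a multiple of it corrects the value at [x m.+1]
    without disturbing the earlier ones. *)
Lemma exists_interpolation (V : nat -> R) :
  exists mu : smeasure R, forall i, (i < n)%N -> fmu mu (x i) = V i.
Proof.
(* The first term has value [V 0] at [x 0 = -1], where [phi (-1, 1)] is [2]. *)
pose f (c : nat -> R) (m : nat) (t : R) :=
  V 0%N / 2 * phi (-1, 1) t + \sum_(j < m) c j * phi (1, x j) t.
suff [c fc] : exists c : nat -> R, forall i, (i < n)%N -> f c n.-1 (x i) = V i.
  pose w r := if r is j.+1 then c j else V 0%N / 2.
  (* [atomic_sm] asks that all [p r] lie in [Uset], even beyond the summation range; hence the
     default knot [1]. *)
  pose p r : R * R := if r is j.+1 then (1, if (j < n)%N then x j else 1) else (-1, 1).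
  have pU r : Uset (p r).
    case: r => [|j]; first by split; [right|rewrite /= lexx andbT; lra].
    by split; [left|rewrite /=; case: ifPn => [/grid_itv//|_]; lra].
  exists (atomic_sm w p n.-1.+1 pU) => i iN; rewrite fmu_atomic_sm -(fc i iN) /f.
  rewrite big_ord_recl/=; congr (_ + _); apply: eq_bigr => j _.
  by rewrite /= ifT//; have := ltn_ord j; lia.
suff H m : (m < n)%N -> exists c : nat -> R,
    forall i, (i <= m)%N -> f c m (x i) = V i.
  have [|c fc] := H n.-1; first by lia.
  by exists c => i iN; apply: fc; lia.
elim: m => [_|m IH mn].
  exists (fun=> 0) => i; rewrite leqn0 => /eqP ->.
  rewrite /f big_ord0 addr0 x0 /phi/= max_l; first by field.
  lra.
have [|c fc] := IH; first exact: ltnW.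
have dx : x m.+1 - x m != 0 by rewrite subr_eq0 gt_eqF// xlt.
pose c' j := if (j == m)%N then (V m.+1 - f c m (x m.+1)) / (x m.+1 - x m) else c j.
have fE t : f c' m.+1 t = f c m t + c' m * phi (1, x m) t.
  rewrite /f big_ord_recr/= addrA; congr (_ + _ + _); apply: eq_bigr => j _.
  by rewrite /c' ltn_eqF.
exists c' => i; rewrite fE leq_eqVlt => /predU1P[->|im].
  rewrite /phi/= mul1r max_l ?subr_ge0 ?(ltW (xlt mn))//.
  by rewrite /c' eqxx divfK// addrC subrK.
rewrite fc// /phi/= mul1r max_r ?mulr0 ?addr0// subr_le0.
by apply: grid_le => //; exact: ltnW.
Qed.

(* [P] selects the nodes; [lo i] and [hi i] are the nodes enclosing [x i, x i.+1]. *)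
Variables (P : pred nat) (lo hi : nat -> nat).
Hypotheses (P0 : P 0%N) (P1 : P n.-1).
Hypothesis lohi : forall i, (i.+1 < n)%N ->
  [/\ P (lo i), P (hi i), (lo i <= i)%N, (i < hi i)%N & (hi i < n)%N].
Hypothesis no_node : forall i j, (i.+1 < n)%N -> P j -> (j < n)%N ->
  (j <= lo i)%N \/ (hi i <= j)%N.

(** An index [r < n.*2] encodes a signed grid point: its parity is the sign and [r./2] the position
    in the grid. *)
Definition sgn_of (r : nat) : R := (-1) ^+ odd r.

(* Indices that are not nodes are sent to [x 0]; their hat function is zero. *)
Definition node_of (j : nat) : nat := if (j < n)%N && P j then j else 0%N.

Definition atom (r : nat) : R * R := (sgn_of r, x (node_of r./2)).

(** Half-open so that the cells are disjoint; the last one also receives the right end [1], so that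
    they cover [[-1, 1]]. *)
Definition cell (i : nat) : set R :=
  `[x i, x i.+1[%classic `|` (if i.+2 == n then [set 1] else set0).

(** For [c] between the nodes [x (lo i)] and [x (hi i)], this is the barycentric coordinate of [c]
    at the one with index [r./2]; it is [0] when [r./2] is neither index. *)
Definition bary (r i : nat) (c : R) : R :=
  ((r./2 == lo i)%:R * (x (hi i) - c) + (r./2 == hi i)%:R * (c - x (lo i)))
  / (x (hi i) - x (lo i)).

Definition hat (r : nat) (u : R * R) : R :=
  \1_[set sgn_of r] u.1 * \sum_(i < n.-1) \1_(cell i) u.2 * bary r i u.2.

Lemma sgn_of_pm1 r : sgn_of r = 1 \/ sgn_of r = -1.
Proof. by rewrite /sgn_of; case: odd; [right|left]. Qed.

Lemma node_ofP j : (node_of j < n)%N /\ P (node_of j).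
Proof. by rewrite /node_of; case: ifPn => [/andP[]//|_]; split=> //; lia. Qed.

Lemma atom_U r : Uset (atom r).
Proof.
by split; [exact: sgn_of_pm1|apply: grid_itv; have [] := node_ofP r./2].
Qed.

Lemma cell_le i c : (i.+1 < n)%N -> cell i c -> x i <= c <= x i.+1.
Proof.
move=> iN [/=|]; first by rewrite in_itv/= => /andP[-> /ltW].
case: eqP => // iE ->; have -> : i.+1 = n.-1 by lia.
by rewrite x1 lexx andbT -x1; apply: grid_le; lia.
Qed.

Lemma cell_inj i j c : (i.+1 < n)%N -> (j.+1 < n)%N -> cell i c -> cell j c -> i = j.
Proof.
wlog ij : i j / (i < j)%N.
  move=> H iN jN ci cj; have [ij|ji|//] := ltngtP i j; first exact: (H i j).
  by apply/esym; exact: (H j i).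
move=> iN jN ci /(cell_le jN)/andP[jc _]; exfalso; case: ci => /=.
  rewrite in_itv/= => /andP[_]; apply/negP; rewrite -leNgt.
  by apply: le_trans jc; apply: grid_le => //; lia.
by case: eqP => // iE; lia.
Qed.

Lemma cell_cover c : -1 <= c <= 1 -> exists2 i, (i.+1 < n)%N & cell i c.
Proof.
move=> /andP[c0]; rewrite le_eqVlt => /predU1P[->|c1].
  by exists n.-2; [lia|right; rewrite ifT//; apply/eqP; lia].
suff H m : (m < n)%N -> c < x m -> exists2 i, (i.+1 < n)%N & cell i c.
  by apply: (H n.-1); [lia|rewrite x1].
elim: m => [|m IH] mn cm; first by move: cm; rewrite x0; lra.
have [cm'|cm'] := ltP c (x m); first by apply: IH => //; exact: ltnW.
by exists m => //; left; rewrite /= in_itv/= cm' cm.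
Qed.

Lemma bary_ge0 r i c : (i.+1 < n)%N -> cell i c -> 0 <= bary r i c.
Proof.
move=> iN /(cell_le iN)/andP[ic ci]; have [_ _ li ih hN] := lohi iN.
have : x (lo i) <= x i by apply: grid_le; lia.
have : x i.+1 <= x (hi i) by exact: grid_le.
move=> a1 a2; apply: divr_ge0; last by lra.
by apply: addr_ge0; apply: mulr_ge0; rewrite ?ler0n//; lra.
Qed.

Lemma hat_ge0 r u : 0 <= hat r u.
Proof.
rewrite mulr_ge0 ?indicE ?ler0n// sumr_ge0// => i _; rewrite indicE.
case: (boolP (_ \in _)) => [/set_mem ci|_]; last by rewrite mul0r.
by rewrite mul1r bary_ge0//; have := ltn_ord i; lia.
Qed.

Lemma measurable_cell i : measurable (cell i).
Proof.
apply: measurableU; first exact: measurable_itv.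
by case: ifP => _; [exact: measurable_set1|exact: measurable0].
Qed.

Lemma measurable_hat r : measurable_fun setT (hat r).
Proof.
have m1 : measurable_fun setT (fun u : R * R => u.1) by exact: measurable_fst.
have m2 : measurable_fun setT (fun u : R * R => u.2) by exact: measurable_snd.
apply: measurable_funM.
  apply: (measurableT_comp _ m1); apply: measurable_indic; exact: measurable_set1.
apply: measurable_sum => i; apply: measurable_funM.
  by apply: (measurableT_comp _ m2); apply: measurable_indic; exact: measurable_cell.
apply: (@measurableT_comp _ _ _ _ _ _ (bary r i) _ snd); last exact: m2.
rewrite /bary; apply: measurable_funM => //.
apply: measurable_funD; apply: measurable_funM => //; exact: measurable_funB.
Qed.

Lemma hat_out r u : ~ Uset u -> hat r u = 0.
Proof.
move=> nU; rewrite /hat indicE.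
case: (boolP (_ \in _)) => [/set_mem /= us|_]; last by rewrite mul0r.
rewrite mul1r big1// => i _; rewrite indicE.
case: (boolP (_ \in _)) => [/set_mem ci|_]; last by rewrite mul0r.
exfalso; apply: nU; split; first by rewrite us; exact: sgn_of_pm1.
have iN : (i.+1 < n)%N by have := ltn_ord i; lia.
have /andP[ic ci'] := cell_le iN ci.
have /andP[a1 _] : -1 <= x i <= 1 by apply: grid_itv; lia.
have /andP[_ a2] := grid_itv iN.
by rewrite (le_trans a1 ic) (le_trans ci' a2).
Qed.

(** At [u] only two hat functions can be nonzero, those of sign [u.1] at the nodes enclosing [u.2].
    The general [G] serves twice: the constant [1] gives the partition of unity, and the values of
    [phi] at the atoms give the decomposition of [phi] at nodes. *)
Lemma sum_hat (G : nat -> R) u : Uset u -> exists (b : bool) (i : nat),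
  [/\ (i.+1 < n)%N, u.1 = (-1) ^+ b, x i <= u.2 <= x i.+1 &
  (x (hi i) - x (lo i)) * \sum_(r < n.*2) G r * hat r u =
  (x (hi i) - u.2) * G ((lo i).*2 + b)%N + (u.2 - x (lo i)) * G ((hi i).*2 + b)%N].
Proof.
move=> [us uc]; have [b ub] : exists b : bool, u.1 = (-1) ^+ b.
  by case: us => ->; [exists false|exists true].
have [i iN ci] := cell_cover uc.
exists b, i; split => //; first exact: cell_le.
have [_ _ li ih hN] := lohi iN.
have D0 : x (hi i) - x (lo i) != 0.
  by rewrite subr_eq0 gt_eqF// grid_lt//; lia.
have hatE r : (x (hi i) - x (lo i)) * (G r * hat r u) =
    (if r == ((lo i).*2 + b)%N then (x (hi i) - u.2) * G r else 0) +
    (if r == ((hi i).*2 + b)%N then (u.2 - x (lo i)) * G r else 0).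
  have -> : hat r u = (odd r == b)%:R * bary r i u.2.
    rewrite /hat ub; congr (_ * _).
      rewrite indicE; congr (nat_of_bool _)%:R; apply/idP/eqP => [/set_mem /=|<-].
        by rewrite /sgn_of; case: (odd r); case: b {ub} => //=; rewrite ?expr0 ?expr1; lra.
      exact/mem_set.
    have ilt : (i < n.-1)%N by lia.
    rewrite (bigD1 (Ordinal ilt))//= indicE mem_set// mul1r big1 ?addr0// => j ji.
    rewrite indicE memNset ?mul0r// => cj; move/eqP: ji; apply; apply: val_inj => /=.
    by apply: cell_inj cj ci => //; have := ltn_ord j; lia.
  (* Decoding of indices: the node [m] with sign bit [b] has index [m.*2 + b]. *)
  have rE m : (r == (m.*2 + b)%N) = (odd r == b) && (r./2 == m).
    apply/eqP/andP => [->|[/eqP <- /eqP <-]]; last by rewrite addnC odd_double_half.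
    by rewrite oddD odd_double oddb addnC half_bit_double !eqxx.
  rewrite !rE /bary; case: (odd r == b) => /=; last by rewrite !(mul0r, mulr0) addr0.
  by case: (r./2 == lo i); case: (r./2 == hi i) => /=; field.
rewrite mulr_sumr; under eq_bigr do rewrite hatE.
rewrite big_split/=; congr (_ + _); rewrite -big_mkcond/=.
  have lt : ((lo i).*2 + b < n.*2)%N by case: b {ub hatE}; lia.
  by rewrite (big_pred1 (Ordinal lt)).
have lt : ((hi i).*2 + b < n.*2)%N by case: b {ub hatE}; lia.
by rewrite (big_pred1 (Ordinal lt)).
Qed.

Lemma sum_hat_le1 u : \sum_(r < n.*2) hat r u <= 1.
Proof.
have [Uu|nU] := pselect (Uset u); last first.
  by rewrite big1// => r _; exact: hat_out.
have [b [i [iN _ _]]] := sum_hat (fun=> 1) Uu.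
under eq_bigr do rewrite mul1r.
rewrite !mulr1 => H; have [_ _ li ih hN] := lohi iN.
have D0 : x (hi i) - x (lo i) != 0.
  by rewrite subr_eq0 gt_eqF// grid_lt//; lia.
suff -> : \sum_(r < n.*2) hat r u = 1 by [].
apply: (mulfI D0); rewrite H; ring.
Qed.

Lemma atom_node j (b : bool) : (j < n)%N -> P j -> atom (j.*2 + b)%N = ((-1) ^+ b, x j).
Proof.
move=> jn Pj; rewrite /atom /sgn_of oddD odd_double/= oddb.
by rewrite addnC half_bit_double /node_of jn Pj.
Qed.

(** [sum_hat] leaves the two nodes enclosing the knot [u.2]. No node lies strictly between them, so
    [phi_convex_comb] applies at [x j]. *)
Lemma phi_sum_hat j u : (j < n)%N -> P j -> Uset u ->
  phi u (x j) = \sum_(r < n.*2) phi (atom r) (x j) * hat r u.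
Proof.
move=> jn Pj Uu.
have [b [i [iN ub /andP[ui ui'] H]]] := sum_hat (fun r => phi (atom r) (x j)) Uu.
have [Pl Ph li ih hN] := lohi iN.
have D0 : x (hi i) - x (lo i) != 0.
  by rewrite subr_eq0 gt_eqF// grid_lt//; lia.
apply: (mulfI D0); rewrite H !atom_node//; last by lia.
have -> : u = ((-1) ^+ b, u.2) by rewrite -ub -surjective_pairing.
apply: phi_convex_comb.
- by case: b {ub H}; [right|left].
- have : x (lo i) <= x i by apply: grid_le; lia.
  have : x i.+1 <= x (hi i) by exact: grid_le.
  by move=> a1 a2; rewrite /=; lra.
- by have [jl|hj] := no_node iN Pj jn; [left|right]; apply: grid_le => //; lia.
Qed.

(** Integrates [phi_sum_hat] term by term: the atoms with weights [sm_int mu (hat r)] keep the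
    values at the nodes. *)
Lemma fmu_node (mu : smeasure R) j : (j < n)%N -> P j ->
  fmu mu (x j) = \sum_(r < n.*2) sm_int mu (hat r) * phi (atom r) (x j).
Proof.
move=> jn Pj; rewrite fmuE (eq_sm_int mu _ _ (fun u => @phi_sum_hat j u jn Pj)).
rewrite (@sm_int_lincomb _ mu _ (fun r : 'I__ => phi (atom r) (x j)) (fun=> 1)
  (fun r : 'I__ => hat r)).
- by apply: eq_bigr => r _; rewrite mulrC.
- by move=> r; exact: measurable_hat.
move=> r u _; rewrite hat_ge0; apply: le_trans (sum_hat_le1 u).
by rewrite (bigD1 r)//= lerDl sumr_ge0// => ? _; exact: hat_ge0.
Qed.

(** All kinks of the atoms are at nodes, hence never strictly between [x (lo i)] and [x (hi i)]. *)
Lemma phi_atom_affine r i : (i.+1 < n)%N ->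
  (x (hi i) - x (lo i)) * phi (atom r) (x i) =
  (x (hi i) - x i) * phi (atom r) (x (lo i)) +
  (x i - x (lo i)) * phi (atom r) (x (hi i)).
Proof.
move=> iN; have [_ _ li ih hN] := lohi iN; have [qn Pq] := node_ofP r./2.
rewrite /atom !(phi_swap (sgn_of r)); apply: phi_convex_comb.
- by have [->|->] := sgn_of_pm1 r; [right|left; rewrite opprK].
- by rewrite !grid_le//; lia.
- by have [jl|hj] := no_node iN Pq qn; [left|right]; apply: grid_le => //; lia.
Qed.

(** * Optimisation under linear constraints on the values at the data points *)

Section LinearConstraints.
Variables (k : nat) (E : Type) (b : nat -> E -> 'I_k -> R) (g : nat -> E -> R).

(** [E] indexes the constraints imposed at one data point; an equation is expressed as a pair of
    opposite inequalities. *)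
Definition lp_feasible (mu : 'I_k -> smeasure R) :=
  forall i, (i < n)%N -> forall e, g i e <= \sum_(l < k) b i e l * fmu (mu l) (x i).

(** This condition and the next make the constraint at a non-node a consequence of those at the
    enclosing nodes, for any function affine between them. *)
Hypothesis b_lohi : forall i e, (i.+1 < n)%N -> ~~ P i ->
  b (lo i) e = b i e /\ b (hi i) e = b i e.
Hypothesis g_lohi : forall i e, (i.+1 < n)%N -> ~~ P i ->
  (x (hi i) - x (lo i)) * g i e <=
  (x (hi i) - x i) * g (lo i) e + (x i - x (lo i)) * g (hi i) e.

Let coef (j : 'I_n * E) (l : 'I_k) (r : 'I_(n.*2)) : R :=
  b j.1 j.2 l * phi (atom r) (x j.1).

Let sum_coef j (a : 'I_k -> 'I_(n.*2) -> R) :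
  \sum_(l < k) \sum_(r < n.*2) coef j l r * a l r =
  \sum_(l < k) b j.1 j.2 l * \sum_(r < n.*2) a l r * phi (atom r) (x j.1).
Proof.
by apply: eq_bigr => l _; rewrite mulr_sumr; apply: eq_bigr => r _; rewrite /coef; ring.
Qed.

(** At a node the value is unchanged, by [fmu_node]. At a non-node, [phi_atom_affine] turns the
    constraint into a convex combination of those that [mu] satisfies at the two enclosing nodes. *)
Lemma lp_feasible_weights (mu : 'I_k -> smeasure R) : lp_feasible mu ->
  forall j : 'I_n * E, g j.1 j.2 <=
    \sum_(l < k) \sum_(r < n.*2) coef j l r * sm_int (mu l) (hat r).
Proof.
move=> muF [i e] /=; rewrite (sum_coef (i, e) (fun l r => sm_int (mu l) (hat r)))/=.
have iN := ltn_ord i.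
have [Pi|nPi] := boolP (P i).
  by under eq_bigr do rewrite -fmu_node//; exact: muF.
have iN' : (i.+1 < n)%N.
  rewrite ltn_neqAle iN andbT; apply: contra nPi => /eqP ie.
  by rewrite (_ : (i : nat) = n.-1)//; lia.
have [Pl Ph li ih hN] := lohi iN'.
have lN : (lo i < n)%N by lia.
have xl : x (lo i) <= x i by exact: grid_le.
have xh : x i <= x (hi i) by apply: grid_le => //; exact: ltnW.
have D0 : 0 < x (hi i) - x (lo i) by rewrite subr_gt0 grid_lt//; lia.
rewrite -(ler_pM2l D0); apply: le_trans (g_lohi e iN' nPi) _.
have [bl bh] := b_lohi e iN' nPi.
have gl := muF _ lN e; have gh := muF _ hN e; rewrite bl in gl; rewrite bh in gh.
apply: (@le_trans _ _ ((x (hi i) - x i) * \sum_(l < k) b i e l * fmu (mu l) (x (lo i)) +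
    (x i - x (lo i)) * \sum_(l < k) b i e l * fmu (mu l) (x (hi i)))).
  by apply: lerD; apply: ler_wpM2l => //; rewrite subr_ge0.
rewrite !mulr_sumr -big_split/= le_eqVlt; apply/predU1P; left.
apply: eq_bigr => l _; rewrite !fmu_node//.
set S := \sum_(r < n.*2) _ * phi _ (x i).
have SE : (x (hi i) - x (lo i)) * S =
  (x (hi i) - x i) * \sum_(r < n.*2) sm_int (mu l) (hat r) * phi (atom r) (x (lo i)) +
  (x i - x (lo i)) * \sum_(r < n.*2) sm_int (mu l) (hat r) * phi (atom r) (x (hi i)).
  rewrite !mulr_sumr -big_split/=; apply: eq_bigr => r _.
  by rewrite mulrCA phi_atom_affine//; ring.
by rewrite [RHS]mulrCA SE; ring.
Qed.

(** [V] shows that the finite problem over weights is feasible. Its minimiser is optimal overall,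
    because any feasible [mu] yields admissible weights of cost at most [tvk mu setT]. *)
Lemma lp_optimum (V : nat -> 'I_k -> R) :
  (forall i, (i < n)%N -> forall e, g i e <= \sum_(l < k) b i e l * V i l) ->
  exists nu : 'I_k -> smeasure R,
    [/\ msupport (tvk nu) `<=`
          [set u | (u.1 = 1 \/ u.1 = -1) /\ exists j, [/\ (j < n)%N, P j & u.2 = x j]],
        lp_feasible nu &
        forall mu, lp_feasible mu -> (tvk nu setT <= tvk mu setT)%E].
Proof.
move=> Vg.
have [mu0 mu0V] := choice (fun l => exists_interpolation (V ^~ l)).
have mu0F : lp_feasible mu0.
  by move=> i iN e; under eq_bigr do rewrite mu0V//; exact: Vg.
have [|a aF amin] := @polyhedral_min R k n.*2 _ coef (fun j => g j.1 j.2).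
  by exists (fun l r => sm_int (mu0 l) (hat r)); exact: lp_feasible_weights.
pose w l r := oapp (a l) 0 (insub r).
have wE l (r : 'I_(n.*2)) : w l r = a l r by rewrite /w valK.
pose nu l := atomic_sm (w l) atom n.*2 atom_U.
have nuE l B : sm_val (nu l) B = \sum_(r < n.*2) \1_B (atom r) * a l r.
  by rewrite atomic_sm_val; apply: eq_bigr => r _; rewrite wE mulrC.
exists nu; split.
- move=> u usupp; apply: contrapT => nu_u.
  (* [nu] vanishes off the finite set [A] of atoms, so the complement of [A] is an open
     neighbourhood of [u] of zero variation. *)
  pose A := [set atom r | r in `I_(n.*2)].
  have finA : finite_set A by apply: finite_image; exact: finite_II.
  have uA : (~` A) u.
    move=> [r _ ru]; apply: nu_u; rewrite -ru; split; first exact: sgn_of_pm1.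
    by have [qn Pq] := node_ofP r./2; exists (node_of r./2).
  have oA : open (~` A).
    apply: closed_openC; have /accessible_finite_set_closed : accessible_space (R * R)%type.
      exact/hausdorff_accessible/norm_hausdorff.
    exact.
  have mA : measurable (~` A).
    apply: measurableC; rewrite /A -bigcup_imset1.
    apply: bigcup_measurable => r _; rewrite (_ : [set atom r] =
      [set (atom r).1] `*` [set (atom r).2]).
      by apply: measurableX; exact: measurable_set1.
    by apply/seteqP; split => [v ->//|v [/= v1 v2]]; rewrite [v]surjective_pairing v1 v2.
  have /eqP := usupp _ oA uA; apply; apply: tvar_eq0 => // B BA.
  rewrite -[LHS]/(enorm (fun l => sm_val (nu l) B)).
  rewrite (_ : (fun l => _) = fun=> 0) ?enorm0//; apply/funext => l.
  rewrite nuE big1// => r _; rewrite indicE memNset ?mul0r// => /BA; apply.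
  by exists r => //=.
- move=> i iN e; have := aF (Ordinal iN, e); rewrite sum_coef/=.
  move=> /le_trans; apply; apply: ler_sum => l _; rewrite fmu_atomic_sm.
  by under [in leRHS]eq_bigr do rewrite wE.
(* Three bounds are chained: the variation of [nu] is at most the minimal cost, which is at most the
   cost of the weights of [mu], which is at most the variation of [mu]. *)
- move=> mu muF; have := amin _ (lp_feasible_weights muF); rewrite -lee_fin => H.
  apply: le_trans (le_trans H _); last first.
    apply: le_tvk_sm_int => [r|r u|u].
    + exact: measurable_hat.
    + exact: hat_ge0.
    + exact: sum_hat_le1.
  apply: (@tvar_le_atoms _ _ _ _ _ (fun r : 'I_(n.*2) => atom r)) => [r|B].
    exact: enorm_ge0.
  rewrite -[leLHS]/(enorm (fun l => sm_val (nu l) B)).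
  rewrite (_ : (fun l => _) = fun l => \sum_(r < n.*2) \1_B (atom r) * a l r).
    apply: le_trans (ler_enorm_sum _ _ _) _.
    by apply: ler_sum => r _; rewrite enormZ ger0_norm ?indicE// mulrC.
  by apply/funext => l; exact: nuE.
Qed.

End LinearConstraints.

End Grid.

(** * Nodes enclosing a data point *)

(** Take the last node at or before [i] and the first node after [i]; they exist because both end
    indices are nodes. *)
Lemma enclosing_nodes (n : nat) (P : pred nat) : P 0%N -> P n.-1 ->
  exists lo hi : nat -> nat,
    (forall i, (i.+1 < n)%N ->
       [/\ P (lo i), P (hi i), (lo i <= i)%N, (i < hi i)%N & (hi i < n)%N]) /\
    (forall i j, (i.+1 < n)%N -> P j -> (j < n)%N -> (j <= lo i)%N \/ (hi i <= j)%N).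
Proof.
move=> P0 P1.
suff /choice[f fP] : forall i, exists lh : nat * nat, (i.+1 < n)%N ->
    [/\ P lh.1, P lh.2, (lh.1 <= i)%N, (i < lh.2)%N & (lh.2 < n)%N] /\
    (forall j, P j -> (j < n)%N -> (j <= lh.1)%N \/ (lh.2 <= j)%N).
  by exists (fun i => (f i).1), (fun i => (f i).2); split=> [i /fP[]|i j /fP[_]]; [|apply].
move=> i; have [iN|] := boolP (i.+1 < n)%N; last by exists (0%N, 0%N).
have exlo : exists j, P j && (j <= i)%N by exists 0%N; rewrite P0.
have bdlo j : P j && (j <= i)%N -> (j <= i)%N by case/andP.
have exhi : exists j, P j && (i < j)%N by exists n.-1; rewrite P1/=; lia.
case: (ex_maxnP exlo bdlo) => l /andP[Pl li] lmax.
case: (ex_minnP exhi) => h /andP[Ph ih] hmin.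
exists (l, h) => _; split=> [|j Pj jn].
  by split=> //=; have := hmin n.-1; rewrite P1/=; lia.
have [ji|ij] := leqP j i; [left|right]; first by apply: lmax; rewrite Pj.
by apply: hmin; rewrite Pj.
Qed.

(** * Regression and classification as linear constraints *)

Lemma tv1E {R : realType} (mu : smeasure R) : tv1 mu = tvk (fun _ : 'I_1 => mu).
Proof.
apply/funext => A; congr (tvar _ A); apply/funext => B.
by rewrite big_ord1 sqrtr_sqr.
Qed.

(** Equal consecutive slopes propagate from [l] to the right, so the increments of [y] are those of
    a single line. *)
Lemma affine_of_slope {R : realType} (x y : nat -> R) (l h j : nat) :
  (forall i, (l <= i < h)%N -> x i < x i.+1) ->
  (forall i, (l < i < h)%N -> slope x y i = slope x y i.-1) ->
  (l <= j <= h)%N -> y j = y l + slope x y l * (x j - x l).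
Proof.
move=> xlt sl.
have slE i : (l <= i < h)%N -> slope x y i = slope x y l.
  elim: i => [|i IH] /andP[li ih]; first by have -> : l = 0%N by lia.
  move: li; rewrite leq_eqVlt => /predU1P[->//|li].
  by rewrite sl ?IH//=; lia.
elim: j => [|j IH] /andP[lj jh].
  by have -> : l = 0%N by [lia]; rewrite subrr mulr0 addr0.
move: lj; rewrite leq_eqVlt => /predU1P[<-|lj]; first by rewrite subrr mulr0 addr0.
have xj : x j.+1 - x j != 0 by rewrite subr_eq0 gt_eqF// xlt//; lia.
have : y j.+1 = y j + slope x y j * (x j.+1 - x j) by rewrite /slope divfK// addrC subrK.
by rewrite slE ?IH; [move=> ->; ring|lia..].
Qed.

(** The index [i] guarantees an interior point: if [h = l.+1], the two end labels could differ. *)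
Lemma constant_labels (T : eqType) (y : nat -> T) (l h i j : nat) :
  (forall i, (l < i < h)%N -> y i.-1 = y i /\ y i.+1 = y i) ->
  (l < i < h)%N -> (l <= j <= h)%N -> y j = y i.
Proof.
move=> yc ilh jlh.
have yl m : (l <= m < h)%N -> y m = y l.
  elim: m => [|m IH] /andP[lm mh]; first by have -> : l = 0%N by lia.
  move: lm; rewrite leq_eqVlt => /predU1P[->//|lm].
  by have [<- _] := yc m.+1 ltac:(lia); rewrite /= IH//; lia.
have [jh|hj] := ltnP j h; first by rewrite (yl j) ?(yl i)//; lia.
have -> : j = h by lia.
have [_] := yc h.-1 ltac:(lia); rewrite prednK; last by lia.
by move=> ->; rewrite (yl h.-1) ?(yl i)//; lia.
Qed.

Lemma regression_optimum {R : realType} (n : nat) (x : nat -> R) :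
  (2 <= n)%N -> x 0%N = -1 -> x n.-1 = 1 ->
  (forall i, (i.+1 < n)%N -> x i < x i.+1) ->
  forall y : nat -> R, exists nu : smeasure R,
    msupport (tv1 nu) `<=` F_reg n x y /\ reg_feasible n x y nu /\
    (forall mu : smeasure R, reg_feasible n x y mu -> (tv1 nu setT <= tv1 mu setT)%E).
Proof.
move=> n2 x0 x1 xlt y.
pose P i := [|| i == 0%N, i == n.-1 | slope x y i != slope x y i.-1].
have P0 : P 0%N by rewrite /P eqxx.
have P1 : P n.-1 by rewrite /P eqxx orbT.
have [lo [hi [lohi nonode]]] := enclosing_nodes n P P0 P1.
(* The two values of [e] give the two inequalities that make up the interpolation equation. *)
pose b (i : nat) (e : bool) (l : 'I_1) : R := (-1) ^+ e.
pose g (i : nat) (e : bool) : R := (-1) ^+ e * y i.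
have feasE mu : lp_feasible n x b g mu <-> reg_feasible n x y (mu ord0).
  split=> [F i iN|F i iN e]; last by rewrite big_ord1 F.
  have := F i iN false; have := F i iN true; rewrite !big_ord1 /b /g/= expr0 expr1.
  by move=> ? ?; lra.
have blh i e : (i.+1 < n)%N -> ~~ P i -> b (lo i) e = b i e /\ b (hi i) e = b i e.
  by [].
have glh i e : (i.+1 < n)%N -> ~~ P i -> (x (hi i) - x (lo i)) * g i e <=
    (x (hi i) - x i) * g (lo i) e + (x i - x (lo i)) * g (hi i) e.
  move=> iN nPi; have [_ _ li ih hN] := lohi i iN.
  have yE := affine_of_slope x y (lo i) (hi i).
  have {}yE j : (lo i <= j <= hi i)%N ->
      y j = y (lo i) + slope x y (lo i) * (x j - x (lo i)).
    apply: yE => m mlh; first by apply: xlt; lia.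
    (* A change of slope at [m] would make [m] a node strictly between [lo i] and [hi i]. *)
    apply/eqP; apply: contraT => sm.
    have Pm : P m by rewrite /P sm !orbT.
    by have [] := nonode i m iN Pm ltac:(lia); lia.
  by rewrite /g (yE i) ?(yE (hi i)); [rewrite le_eqVlt; apply/predU1P; left; ring|lia..].
have Vg i : (i < n)%N -> forall e, g i e <= \sum_(l < 1) b i e l * y i.
  by move=> iN e; rewrite big_ord1.
have [nu [supp nuF nuopt]] :=
  lp_optimum n2 x0 x1 xlt P0 P1 lohi nonode blh glh (V := fun i _ => y i) Vg.
exists (nu ord0); rewrite tv1E.
have nu0 : (fun _ : 'I_1 => nu ord0) = nu by apply/funext => l; rewrite (ord1 l).
rewrite nu0; split; last split.
- move=> u /supp[us [j [jn Pj uj]]]; split=> //; rewrite uj.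
  move: Pj => /or3P[/eqP ->|/eqP ->|sj]; [by left|by right; left|].
  have [->|j0] := eqVneq j 0%N; first by left.
  have [->|j1] := eqVneq j n.-1; first by right; left.
  by right; right; exists j; split; [lia|split; [lia|]].
- exact/feasE.
- by move=> mu muF; rewrite tv1E; apply: nuopt; exact/feasE.
Qed.

Lemma classification_optimum {R : realType} (n : nat) (x : nat -> R) :
  (2 <= n)%N -> x 0%N = -1 -> x n.-1 = 1 ->
  (forall i, (i.+1 < n)%N -> x i < x i.+1) ->
  forall (k : nat) (y : nat -> 'I_k), exists nu : 'I_k -> smeasure R,
    msupport (tvk nu) `<=` F_class n x y /\ class_feasible n x y nu /\
    (forall mu : 'I_k -> smeasure R, class_feasible n x y mu ->
       (tvk nu setT <= tvk mu setT)%E).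
Proof.
move=> n2 x0 x1 xlt k y.
pose P i := [|| i == 0%N, i == n.-1 | (y i.-1 != y i) || (y i.+1 != y i)].
have P0 : P 0%N by rewrite /P eqxx.
have P1 : P n.-1 by rewrite /P eqxx orbT.
have [lo [hi [lohi nonode]]] := enclosing_nodes n P P0 P1.
(* The coefficients are those of the difference of the basis vectors for [y i] and [e]. *)
pose b (i : nat) (e l : 'I_k) : R := (l == y i)%:R - (l == e)%:R.
pose g (i : nat) (e : 'I_k) : R := if y i != e then 1 else 0.
have sumb i e (v : 'I_k -> R) : \sum_(l < k) b i e l * v l = v (y i) - v e.
  have pick m : \sum_(l < k) (l == m)%:R * v l = v m.
    rewrite (bigD1 m)//= eqxx mul1r big1 ?addr0// => l /negbTE ->.
    by rewrite mul0r.
  by under eq_bigr do rewrite mulrBl; rewrite sumrB !pick.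
have feasE mu : lp_feasible n x b g mu <-> class_feasible n x y mu.
  by split=> F i iN e; have := F i iN e; rewrite sumb.
have ylohi i : (i.+1 < n)%N -> ~~ P i -> y (lo i) = y i /\ y (hi i) = y i.
  move=> iN nPi; have [Pl _ li ih hN] := lohi i iN.
  (* [lo i] is a node and [i] is not, so [i] is strictly inside, as [constant_labels] requires. *)
  have il : (lo i < i)%N.
    by rewrite ltn_neqAle li andbT; apply: contra nPi => /eqP <-.
  have yc m : (lo i < m < hi i)%N -> y m.-1 = y m /\ y m.+1 = y m.
    move=> mlh; have nPm : ~~ P m.
      by apply/negP => Pm; have [] := nonode i m iN Pm ltac:(lia); lia.
    by move: nPm; rewrite /P !negb_or !negbK => /and3P[_ _ /andP[/eqP ? /eqP ?]].
  by split; apply: (constant_labels _ _ _ _ _ _ yc); lia.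
have blh i e : (i.+1 < n)%N -> ~~ P i -> b (lo i) e = b i e /\ b (hi i) e = b i e.
  by move=> iN nPi; have [yl yh] := ylohi i iN nPi; rewrite /b yl yh.
have glh i e : (i.+1 < n)%N -> ~~ P i -> (x (hi i) - x (lo i)) * g i e <=
    (x (hi i) - x i) * g (lo i) e + (x i - x (lo i)) * g (hi i) e.
  move=> iN nPi; have [yl yh] := ylohi i iN nPi.
  by rewrite /g yl yh le_eqVlt; apply/predU1P; left; ring.
(* One-hot targets meet every margin constraint. *)
have Vg i : (i < n)%N -> forall e, g i e <= \sum_(l < k) b i e l * (l == y i)%:R.
  by move=> iN e; rewrite sumb eqxx /g eq_sym; case: eqP => _ /=; lra.
have [nu [supp nuF nuopt]] :=
  lp_optimum n2 x0 x1 xlt P0 P1 lohi nonode blh glh (V := fun i l => (l == y i)%:R) Vg.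
exists nu; split; last split.
- move=> u /supp[us [j [jn Pj uj]]]; split=> //; rewrite uj.
  move: Pj => /or3P[/eqP ->|/eqP ->|/orP sj]; [by left|by right; left|].
  have [->|j0] := eqVneq j 0%N; first by left.
  have [->|j1] := eqVneq j n.-1; first by right; left.
  by right; right; exists j; split; [lia|split; [lia|]].
- exact/feasE.
- by move=> mu muF; apply: nuopt; exact/feasE.
Qed.

Theorem theorem1 (R : realType) (n : nat) (x : nat -> R) :
  (2 <= n)%N ->
  x 0%N = -1 -> x n.-1 = 1 ->
  (forall i, (i.+1 < n)%N -> x i < x i.+1) ->
  (forall y : nat -> R,
     exists nu : smeasure R,
       msupport (tv1 nu) `<=` F_reg n x y /\
       reg_feasible n x y nu /\
       (forall mu : smeasure R, reg_feasible n x y mu ->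
          (tv1 nu setT <= tv1 mu setT)%E)) /\
  (forall (k : nat) (y : nat -> 'I_k), (1 <= k)%N ->
     exists nu : 'I_k -> smeasure R,
       msupport (tvk nu) `<=` F_class n x y /\
       class_feasible n x y nu /\
       (forall mu : 'I_k -> smeasure R, class_feasible n x y mu ->
          (tvk nu setT <= tvk mu setT)%E)).
Proof.
move=> n2 x0 x1 xlt; split; first exact: regression_optimum.
by move=> k y _; exact: classification_optimum.
Qed.
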